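(* For all integers $n\ge1$ and $m\ge0$, the number of matchings on $[2n]$ that avoid both patterns $12312$ and $121323$ and have exactly $m$ crossings equals $$\frac{1}{n}\binom{n}{m}\binom{2n-m}{n+1}.$$
   Context: A matching on $[2n]$ is a partition of $[2n]$ into $n$ blocks of size two (edges), written $(i,j)$ with $i<j$; edges $(i,j),(i',j')$ cross if $i<i'<j<j'$ or $i'<i<j'<j$, and the number of crossings is the number of unordered pairs of crossing edges. The canonical sequential form of a matching with $n$ edges is the word of length $2n$ obtained by labeling edges $1,\dots,n$ in increasing order of initial points and writing at each position the label of the edge containing it. Words $a_1\cdots a_k$, $b_1\cdots b_k$ are order-isomorphic if $a_i<a_j\iff b_i<b_j$ for all $i,j$. A matching contains a pattern $\tau$ if its canonical sequential form has a subsequence order-isomorphic to $\tau$, and avoids $\tau$ otherwise. *)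

(* Defs.v *)
From mathcomp Require Import all_boot.

Set Implicit Arguments.
Unset Strict Implicit.
Unset Printing Implicit Defensive.

(* The ground set [2n] = {1, ..., 2n} is encoded as 'I_(2 * n) = {0, ..., 2n-1};
   every notion below depends only on the relative order of the points. *)
Definition is_matching (n : nat) (M : {set {set 'I_(2 * n)}}) : bool :=
  partition M [set: 'I_(2 * n)] && [forall e in M, #|e| == 2].

(* i and i' range over the initial points of e and f, since i < j and i' < j'
   are implied by either chain of inequalities. *)
Definition crossing (N : nat) (e f : {set 'I_N}) : bool :=
  [exists i : 'I_N, exists j : 'I_N, exists i' : 'I_N, exists j' : 'I_N,
     [&& e == [set i; j], f == [set i'; j'] &
         [&& i < i', i' < j & j < j'] || [&& i' < i, i < j' & j' < j]]].

Definition crossings (N : nat) (M : {set {set 'I_N}}) : nat :=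
  #|[set P : {set {set 'I_N}} |
       [exists e in M, exists f in M, (P == [set e; f]) && crossing e f]]|.

(* The smallest element of e; the default N is only reached when e is empty. *)
Definition initial_point (N : nat) (e : {set 'I_N}) : nat :=
  \big[minn/N]_(i in e) (i : nat).

(* The rank (starting from 1) of e among the edges of M sorted by increasing
   initial point. *)
Definition edge_label (N : nat) (M : {set {set 'I_N}}) (e : {set 'I_N}) : nat :=
  #|[set f in M | initial_point f <= initial_point e]|.

Definition canonical_form (N : nat) (M : {set {set 'I_N}}) : seq nat :=
  [seq edge_label M (pblock M i) | i <- enum 'I_N].

Definition order_isomorphic (a b : seq nat) : bool :=
  (size a == size b) &&
  [forall i : 'I_(size a), forall j : 'I_(size a),
     (nth 0 a i < nth 0 a j) == (nth 0 b i < nth 0 b j)].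

(* The subsequences of w are exactly the words mask s w, for s a bit mask of
   the same length as w. *)
Definition word_contains (w tau : seq nat) : bool :=
  [exists s : (size w).-tuple bool, order_isomorphic (mask s w) tau].

Definition avoids (N : nat) (M : {set {set 'I_N}}) (tau : seq nat) : bool :=
  ~~ word_contains (canonical_form M) tau.

(* Main.v *)
Require Import Defs.
From mathcomp Require Import all_boot all_order all_algebra.
From mathcomp Require Import zify ring.

(** Every matching arises from a smaller one by inserting a new first arc, which
    is determined by the gap where it ends. In a matching avoiding both patterns,
    such an insertion preserves avoidance for exactly the following gaps: the
    b boundaries (the gaps covered by no arc), where no crossing is created, and
    one gap in each of the b - 1 components between consecutive boundaries, where
    one crossing is created. The number of boundaries becomes each of 2, .., b + 1
    once in the first case and each of 2, .., b once in the second. The resulting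
    generating tree is that of the Schroeder paths without level step on the
    ground, crossings being level steps; adding these numbers for m and m - 1
    gives the numbers of all Schroeder paths, which are quotients of factorials. *)

Set Implicit Arguments.
Unset Strict Implicit.
Unset Printing Implicit Defensive.

(** * Schroeder paths *)

Definition lag (g : nat -> nat) (d : nat) : nat := if d is d'.+1 then g d' else 0.

(* The number of ways to insert k further first arcs into an avoider with b
   boundaries (see [sum_good_gaps]) so that d further crossings appear. *)
Fixpoint descendants (k d b : nat) : nat :=
  if k is k'.+1 then
    \sum_(2 <= j < b.+2) descendants k' d j
      + lag (fun d' => \sum_(2 <= j < b.+1) descendants k' d' j) d
  else d == 0.

(* For b > 0, the number of paths from height b - 1 to height 0, never going
   below 0, with d level steps and n - d up steps. *)
Fixpoint schroeder (n d b : nat) : nat :=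
  if n is n'.+1 then
    \sum_(0 <= j < b) (schroeder n' d j.+2 + lag (fun d' => schroeder n' d' j.+1) d)
  else d == 0.

Lemma descendantsS1 k d : descendants k.+1 d 1 = descendants k d 2.
Proof. by rewrite /= big_nat1; case: d => [|d] /=; rewrite ?big_geq ?addn0. Qed.

Lemma descendantsSS k d b : descendants k.+1 d b.+2 =
  descendants k.+1 d b.+1 + descendants k d b.+3 + lag (descendants k ^~ b.+2) d.
Proof.
rewrite /= (big_nat_recr b.+3) //=.
by case: d => [|d] //=; rewrite ?(big_nat_recr b.+2) //=; lia.
Qed.

Lemma schroederS0 n d : schroeder n.+1 d 0 = 0.
Proof. by rewrite /= big_geq. Qed.

Lemma schroederSS n d b : schroeder n.+1 d b.+1 =
  schroeder n.+1 d b + schroeder n d b.+2 + lag (schroeder n ^~ b.+1) d.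
Proof. by rewrite /= big_nat_recr //= addnA. Qed.

Arguments descendants : simpl never.
Arguments schroeder : simpl never.

(* The coefficientwise form of (1 + q) F F'^b = F'^(b+1) + q F'^b, where F' counts
   the Schroeder paths and F those without level step on the ground. *)
Lemma descendants_schroeder n d b :
  descendants n d b.+1 + lag (descendants n ^~ b.+1) d =
  schroeder n d b.+1 + lag (schroeder n ^~ b) d.
Proof.
elim: n d b => [|n IHn] d b; first by case: d.
elim: b d => [|b IHb] d.
  rewrite schroederSS schroederS0 add0n descendantsS1.
  case: d => [|d]; first by move: (IHn 0 1); rewrite /lag; lia.
  by move: (IHn d.+1 1); rewrite /lag descendantsS1 schroederS0 addn0.
(* Both sides obey the same recurrence in b. Its three terms are matched by [IHb], by [IHn] at b.+2
   and, with one level step less, by [IHn] at b.+1. *)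
rewrite schroederSS descendantsSS.
move: (IHb d) (IHn d b.+2); case: d => [|d].
  by rewrite /lag; lia.
move: (IHn d b.+1).
by rewrite /= descendantsSS !schroederSS; case: d => [|d] /=; lia.
Qed.

Lemma schroeder_gt n d b : n < d -> schroeder n d b = 0.
Proof.
elim: n d b => [|n IHn] [|d] b //= lt_nd.
rewrite /schroeder -/schroeder big1_seq // => j _; rewrite /lag !IHn //; lia.
Qed.

Lemma fact_pred x : 0 < x -> x`! = x * x.-1`!.
Proof. by case: x => // x _; rewrite factS. Qed.

(** There are b.+1 / (k + b.+1) times binomial(2k + b, k) paths from height b with k up steps and no
    level step, and d level steps can be placed in them in binomial(2k + d + b, d) ways.
    Denominators are cleared to stay within the naturals, and the proof is an induction along
    [schroederSS]. *)
Lemma schroeder_fact k d b :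
  schroeder (k + d) d b.+1 * (d`! * k`! * (k + b.+1)`!) = b.+1 * (2 * k + d + b)`!.
Proof.
move En: (k + d) => n.
elim: n k d En b => [|n IHn] k d En b.
  have [-> ->] : k = 0 /\ d = 0 by lia.
  by rewrite /schroeder fact0 mul1n !mul1n add0n factS.
(* Over a common denominator the three terms of [schroederSS] have weights c.+2 * k, c.+1 * d and c
   * (k + c.+1), which add up to c.+1 * (2 * k + d + c). *)
have recur c : b = c ->
  schroeder n d c.+2 * (d`! * k`! * (k + c.+1)`!) = c.+2 * k * (2 * k + d + c).-1`! ->
  lag (schroeder n ^~ c.+1) d * (d`! * k`! * (k + c.+1)`!) =
     c.+1 * d * (2 * k + d + c).-1`! ->
  schroeder n.+1 d c * (d`! * k`! * (k + c.+1)`!) = c * (k + c.+1) * (2 * k + d + c).-1`! ->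
  schroeder n.+1 d b.+1 * (d`! * k`! * (k + b.+1)`!) = b.+1 * (2 * k + d + b)`!.
  move=> -> E1 E2 E3; rewrite schroederSS !mulnDl E1 E2 E3.
  have -> : (2 * k + d + c)`! = (2 * k + d + c) * (2 * k + d + c).-1`!.
    by apply: fact_pred; lia.
  lia.
have S1 c : schroeder n d c.+2 * (d`! * k`! * (k + c.+1)`!) =
            c.+2 * k * (2 * k + d + c).-1`!.
  case: k En {recur} => [|k] En.
    (* For k = 0, d exceeds n and no path is left. *)
    by rewrite schroeder_gt ?mul0n ?muln0 //; lia.
  have /(_ c.+1) := IHn k d ltac:(lia).
  rewrite (_ : 2 * k + d + c.+1 = (2 * k.+1 + d + c).-1); last lia.
  rewrite (_ : k + c.+2 = k.+1 + c.+1) => [E|]; last lia.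
  by rewrite factS [RHS]mulnAC -E; ring.
have S2 c : lag (schroeder n ^~ c.+1) d * (d`! * k`! * (k + c.+1)`!) =
     c.+1 * d * (2 * k + d + c).-1`!.
  case: d En {recur S1} => [|d] En; first by rewrite /= muln0 !mul0n.
  have /(_ c) := IHn k d ltac:(lia).
  rewrite (_ : (2 * k + d.+1 + c).-1 = 2 * k + d + c) /=; last lia.
  by move=> E; rewrite factS [RHS]mulnAC -E; ring.
apply: (recur b) => //.
elim: b {recur} => [|c IHc]; first by rewrite schroederS0.
rewrite schroederSS.
have F1 := S1 c; have F2 := S2 c.
have F0 : (2 * k + d + c.+1).-1`! = (2 * k + d + c) * (2 * k + d + c).-1`!.
  by rewrite addnS -pred_Sn; apply: fact_pred; lia.
rewrite F0 (addnS k c.+1) factS.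
have -> : (schroeder n.+1 d c + schroeder n d c.+2 + lag (schroeder n ^~ c.+1) d) *
  (d`! * k`! * ((k + c.+1).+1 * (k + c.+1)`!)) =
  (k + c.+1).+1 * (schroeder n.+1 d c * (d`! * k`! * (k + c.+1)`!)
   + schroeder n d c.+2 * (d`! * k`! * (k + c.+1)`!)
   + lag (schroeder n ^~ c.+1) d * (d`! * k`! * (k + c.+1)`!)) by ring.
rewrite F1 F2 IHc; ring.
Qed.

(** Together with [descendants_schroeder], this shows that the claimed numbers and [descendants]
    have the same sums over two consecutive numbers of crossings. *)
Lemma schroeder1_bin k d : let n := k + d.+1 in
  n * schroeder n d.+1 1 =
  'C(n, d.+1) * 'C(2 * n - d.+1, n.+1) + 'C(n, d) * 'C(2 * n - d, n.+1).
Proof.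
move=> n; have fn := schroeder_fact k d.+1 0.
rewrite addn0 addn1 mul1n -/n in fn.
have B1 : 'C(n, d.+1) * (d.+1`! * k`!) = n`!.
  by have := @bin_fact n d.+1 ltac:(lia); rewrite (_ : n - d.+1 = k) //; lia.
have B2 : 'C(n, d) * (d`! * k.+1`!) = n`!.
  by have := @bin_fact n d ltac:(lia); rewrite (_ : n - d = k.+1) //; lia.
(* The factor k covers the case k = 0, where the binomial is zero. *)
have B3 : 'C(2 * n - d.+1, n.+1) * (n.+1`! * k.+1`!) = k * k.+1 * (2 * k + d.+1)`!.
  case: k @n {fn B1 B2} => [|k] n; first by rewrite bin_small //; lia.
  have := @bin_fact (2 * n - d.+1) n.+1 ltac:(lia).
  rewrite (_ : 2 * n - d.+1 - n.+1 = k); last lia.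
  rewrite (_ : 2 * n - d.+1 = 2 * k.+1 + d.+1); last lia.
  by move=> <-; rewrite !(factS k.+1) !(factS k); ring.
have B4 : 'C(2 * n - d, n.+1) * (n.+1`! * k`!) = (2 * k + d.+2) * (2 * k + d.+1)`!.
  have := @bin_fact (2 * n - d) n.+1 ltac:(lia).
  rewrite (_ : 2 * n - d - n.+1 = k); last lia.
  move=> ->; rewrite (_ : 2 * n - d = (2 * k + d.+1).+1); last lia.
  by rewrite factS (addnS _ d.+1).
apply/eqP; rewrite -(eqn_pmul2r (_ : 0 < d.+1`! * k`! * k.+1`! * n.+1`!)); last first.
  by rewrite !muln_gt0 !fact_gt0.
apply/eqP; transitivity (n * (2 * k + d.+1)`! * n.+1`!); first by rewrite -fn; ring.
rewrite mulnDl.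
(* With each binomial next to its denominators, what remains is n * n.+1 = k * k.+1 + d.+1 * (2 * k
   + d.+2) for n = k + d.+1. *)
transitivity ('C(n, d.+1) * (d.+1`! * k`!) * ('C(2 * n - d.+1, n.+1) * (n.+1`! * k.+1`!))
  + d.+1 * ('C(n, d) * (d`! * k.+1`!)) * ('C(2 * n - d, n.+1) * (n.+1`! * k`!))).
  by rewrite B1 B2 B3 B4 factS /n; ring.
rewrite (factS d); ring.
Qed.

(** Induction on d: the sum of the values at d and d.+1 is a number of Schroeder paths, from which
    the value at d is subtracted. *)
Lemma descendants1 n d : 0 < n ->
  n * descendants n d 1 = 'C(n, d) * 'C(2 * n - d, n.+1).
Proof.
move=> n_gt0; elim: d => [|d IHd].
  have := descendants_schroeder n 0 0; rewrite /lag !addn0 => ->.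
  have := schroeder_fact n 0 0; rewrite !addn0 addn1 fact0 !mul1n => fn.
  have := @bin_fact (2 * n) n.+1 ltac:(lia).
  rewrite bin0 mul1n subn0 (_ : 2 * n - n.+1 = n.-1); last lia.
  move=> bn; apply/eqP.
  rewrite -(eqn_pmul2r (_ : 0 < n.+1`! * n.-1`!)) ?muln_gt0 ?fact_gt0 //.
  rewrite bn -fn; apply/eqP; case: n n_gt0 {fn bn} => // n _.
  by rewrite -pred_Sn (factS n); ring.
have := descendants_schroeder n d.+1 0; rewrite /lag.
have -> : schroeder n d 0 = 0 by case: n n_gt0 {IHd} => // n _; rewrite schroederS0.
rewrite addn0 => E; have := congr1 (muln n) E; rewrite mulnDr IHd.
have [lt_nd|] := ltnP n d.+1.
  rewrite schroeder_gt // (bin_small lt_nd) !(@bin_small _ n.+1); lia.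
move=> le_dn; have := schroeder1_bin (n - d.+1) d.
by rewrite /= (_ : n - d.+1 + d.+1 = n); lia.
Qed.

(** * Insertion of a first arc *)

Local Notation pt := (nth 0).

(* A matching is encoded by the list whose i-th entry is the partner of i, that
   is, by an involution without fixed point. *)
Definition is_partner_list (w : seq nat) : bool :=
  all (fun i => [&& pt w i < size w, pt w (pt w i) == i & pt w i != i])
      (iota 0 (size w)).

Definition has2 (N : nat) (R : nat -> nat -> bool) : bool :=
  has (fun i => has (R i) (iota 0 N)) (iota 0 N).

Definition has3 (N : nat) (R : nat -> nat -> nat -> bool) : bool :=
  has (fun i => has2 N (R i)) (iota 0 N).

(* Here i, j, k are the initial points of the three arcs; the condition
   k < pt w k says that k is an initial point. *)
Definition contains12312 (w : seq nat) : bool :=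
  has3 (size w) (fun i j k =>
    [&& i < j, j < k, k < pt w i, pt w i < pt w j & k < pt w k]).

Definition contains121323 (w : seq nat) : bool :=
  has3 (size w) (fun i j k =>
    [&& i < j, j < pt w i, pt w i < k, k < pt w j & pt w j < pt w k]).

Definition avoider (w : seq nat) : bool :=
  ~~ contains12312 w && ~~ contains121323 w.

Definition crossing_number (w : seq nat) : nat :=
  \sum_(i <- iota 0 (size w)) \sum_(j <- iota 0 (size w))
    [&& i < j, j < pt w i & pt w i < pt w j].

(* The gaps of w are numbered from 0 to size w, the gap p being the one just
   before the position p. *)
Definition open_arcs (w : seq nat) (p : nat) : nat :=
  count (fun i => i < p <= pt w i) (iota 0 (size w)).

Definition boundary (w : seq nat) (p : nat) : bool := open_arcs w p == 0.

Definition boundaries (w : seq nat) : nat :=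
  count (boundary w) (iota 0 (size w).+1).

(** The position to which i moves when a new arc joins 0 to p.+1. *)
Definition shift (p i : nat) : nat := if i < p then i.+1 else i.+2.

Definition insert_arc (p : nat) (w : seq nat) : seq nat :=
  p.+1 :: take p (map (shift p) w) ++ 0 :: drop p (map (shift p) w).

(* Closing a new first arc at the gap p creates no occurrence of the patterns
   with the new arc in the role of the letter 1. *)
Definition good_gap (w : seq nat) (p : nat) : bool :=
  ~~ has2 (size w) (fun j k => [&& j < k, k < p, p <= pt w j & k < pt w k]) &&
  ~~ has2 (size w) (fun j k => [&& j < p, p <= k, k < pt w j & pt w j < pt w k]).

Lemma has2P N (R : nat -> nat -> bool) : reflect (exists i j, [/\ i < N, j < N & R i j]) (has2 N R).
Proof.
apply: (iffP hasP) => [[i + /hasP[j]]|[i [j [iN jN Rij]]]].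
  by rewrite !mem_iota /= => iN jN Rij; exists i, j.
by exists i; [rewrite mem_iota | apply/hasP; exists j; rewrite ?mem_iota].
Qed.

Lemma has3P N (R : nat -> nat -> nat -> bool) :
  reflect (exists i j k, [/\ i < N, j < N, k < N & R i j k]) (has3 N R).
Proof.
apply: (iffP hasP) => [[i + /has2P[j [k [jN kN Rijk]]]]|[i [j [k [iN jN kN Rijk]]]]].
  by rewrite mem_iota /= => iN; exists i, j, k.
by exists i; [rewrite mem_iota | apply/has2P; exists j, k].
Qed.

Lemma partner_listP w :
  reflect (forall i, i < size w ->
             [/\ pt w i < size w, pt w (pt w i) = i & pt w i <> i])
          (is_partner_list w).
Proof.
apply: (iffP allP) => [wP i iN|wP i].
  by have := wP i; rewrite mem_iota => /(_ iN) /and3P[? /eqP ? /eqP ?].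
by rewrite mem_iota => /wP[-> -> /eqP ->]; rewrite eqxx.
Qed.

(** Reading out of range gives the default 0, so the inequalities of a pattern already bound its
    indices. *)
Lemma nth_gt_size w i x : x < pt w i -> i < size w.
Proof. by case: (ltnP i (size w)) => // le; rewrite nth_default. Qed.

Lemma contains12312P w : reflect
  (exists i j k, [/\ i < j, j < k, k < pt w i, pt w i < pt w j & k < pt w k])
  (contains12312 w).
Proof.
apply: (iffP (has3P _ _)) => [[i [j [k [_ _ _ /and5P H]]]]|[i [j [k H]]]].
  by exists i, j, k.
exists i, j, k; case: H => ? ? ki ij kk.
by rewrite !(nth_gt_size ki, nth_gt_size ij, nth_gt_size kk); split=> //; apply/and5P.
Qed.

Lemma contains121323P w : reflect
  (exists i j k, [/\ i < j, j < pt w i, pt w i < k, k < pt w j & pt w j < pt w k])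
  (contains121323 w).
Proof.
apply: (iffP (has3P _ _)) => [[i [j [k [_ _ _ /and5P H]]]]|[i [j [k H]]]].
  by exists i, j, k.
exists i, j, k; case: H => ? ji ? kj jk.
by rewrite !(nth_gt_size ji, nth_gt_size kj, nth_gt_size jk); split=> //; apply/and5P.
Qed.

Lemma good_gapP w p : reflect
  ((forall j k, j < k -> k < p -> p <= pt w j -> k < pt w k -> False) /\
   (forall j k, j < p -> p <= k -> k < pt w j -> pt w j < pt w k -> False))
  (good_gap w p).
Proof.
apply: (iffP andP) => [[/has2P A /has2P B]|[A B]]; split.
- move=> j k jk kp pj kk; case: A; exists j, k; rewrite jk kp pj kk.
  by rewrite (nth_gt_size kk) (@nth_gt_size w j j) //; lia.
- move=> j k jp pk kj jk; case: B; exists j, k; rewrite jp pk kj jk.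
  by rewrite (nth_gt_size kj) (nth_gt_size jk).
- by apply/has2P=> -[j [k [_ _ /and4P[? ? ? ?]]]]; apply: (A j k).
- by apply/has2P=> -[j [k [_ _ /and4P[? ? ? ?]]]]; apply: (B j k).
Qed.

Lemma boundaryP w p :
  reflect (forall i, i < p -> p <= pt w i -> False) (boundary w p).
Proof.
rewrite /boundary /open_arcs eqn0Ngt -has_count; apply: (iffP hasPn) => [H i ip pi|H i _].
  have /(@nth_gt_size w i) iN : i < pt w i by lia.
  by move: (H i); rewrite mem_iota iN ip pi => /(_ isT).
by apply/negP=> /andP[]; apply: H.
Qed.

Lemma not_boundaryP w p :
  reflect (exists2 i, i < p & p <= pt w i) (~~ boundary w p).
Proof.
rewrite /boundary /open_arcs -lt0n -has_count; apply: (iffP hasP) => [[i _ /andP[]]|[i ip pi]].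
  by exists i.
exists i; last by rewrite ip pi.
by rewrite mem_iota (@nth_gt_size w i i) //; lia.
Qed.

Lemma ltn_shift p i j : (shift p i < shift p j) = (i < j).
Proof. by rewrite /shift; case: ifP; case: ifP; lia. Qed.

Lemma shift_inj p : injective (shift p).
Proof. by move=> i j; rewrite /shift; case: ifP; case: ifP; lia. Qed.

Lemma shift_leq p i : (shift p i <= p) = (i < p).
Proof. by rewrite /shift; case: ifP; lia. Qed.

Lemma ltn_shiftr p i : (p.+1 < shift p i) = (p <= i).
Proof. by rewrite /shift; case: ifP; lia. Qed.

Lemma shift_gt0 p i : (0 < shift p i) = true.
Proof. by rewrite /shift; case: ifP. Qed.

Lemma size_insert_arc p w : size (insert_arc p w) = (size w).+2.
Proof.
by rewrite /insert_arc /= size_cat /= addnS -size_cat cat_take_drop size_map.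
Qed.

Lemma nth_insert_arc0 p w : pt (insert_arc p w) 0 = p.+1.
Proof. by []. Qed.

Lemma nth_insert_arc1 p w : p <= size w -> pt (insert_arc p w) p.+1 = 0.
Proof.
by move=> pN; rewrite /= nth_cat size_takel ?size_map // ltnn subnn.
Qed.

Lemma nth_insert_arc p w i : p <= size w -> i < size w ->
  pt (insert_arc p w) (shift p i) = shift p (pt w i).
Proof.
move=> pN iN; rewrite {1}/shift; case: ltnP => ip /=.
  by rewrite nth_cat size_takel ?size_map // ip nth_take // (nth_map 0).
rewrite nth_cat size_takel ?size_map // ltnNge (leq_trans ip) //= subSn //=.
by rewrite nth_drop subnKC // (nth_map 0).
Qed.

Arguments insert_arc : simpl never.

Lemma insert_arc_cases N p j : p <= N -> j < N.+2 ->
  [\/ j = 0, j = p.+1 | exists2 i, i < N & j = shift p i].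
Proof.
move=> pN jN; case: (ltngtP j p.+1) => [jp|jp|->]; last by constructor 2.
  case: j jp jN => [|j] jp jN; first by constructor 1.
  by constructor 3; exists j; rewrite /shift; [lia | case: ifP; lia].
by constructor 3; exists j.-2; rewrite /shift; [lia | case: ifP; lia].
Qed.

Lemma perm_iota_shift N p : p <= N ->
  perm_eq (iota 0 N.+2) [:: 0, p.+1 & map (shift p) (iota 0 N)].
Proof.
move=> pN; apply: uniq_perm; first exact: iota_uniq.
  rewrite /= inE negb_or (map_inj_uniq (@shift_inj p)) iota_uniq !andbT /=.
  apply/andP; split; apply/mapP => -[i _]; rewrite /shift; case: ifP; lia.
move=> j; rewrite mem_iota /= !inE; apply/idP/idP => [jN|].
  case: (insert_arc_cases pN jN) => [->|->|[i iN ->]]; rewrite ?eqxx ?orbT //.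
  by rewrite map_f ?orbT // mem_iota.
case/or3P => [/eqP->|/eqP->|/mapP[i]] //; rewrite mem_iota => /andP[_ iN] -> /=.
by rewrite /shift; case: ifP; lia.
Qed.

Lemma insert_arc_partner p w : p <= size w ->
  is_partner_list w -> is_partner_list (insert_arc p w).
Proof.
move=> pN /partner_listP wP; apply/partner_listP => j; rewrite size_insert_arc => jN.
case: (insert_arc_cases pN jN) => [->|->|[i iN ->]].
- by rewrite nth_insert_arc0 nth_insert_arc1 //; split=> //; lia.
- by rewrite nth_insert_arc1 // nth_insert_arc0; split=> //; lia.
have [tN tt tn] := wP i iN; rewrite !nth_insert_arc // tt.
by split=> //; [rewrite /shift; case: ifP; lia | move/shift_inj].
Qed.

Lemma partner_insert_arc N w : size w = N.+2 -> is_partner_list w ->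
  exists p w', [/\ p <= N, size w' = N, is_partner_list w' & w = insert_arc p w'].
Proof.
move=> sw /partner_listP wP; rewrite sw in wP.
have [w0N w00 w0n] := wP 0 isT.
pose p := (pt w 0).-1; have pE : pt w 0 = p.+1 by rewrite /p; lia.
have pN : p <= N by lia.
pose unshift j := if j <= p then j.-1 else j.-2.
have shiftK i : unshift (shift p i) = i.
  by rewrite /unshift shift_leq /shift; case: ltnP.
pose w' := mkseq (fun i => unshift (pt w (shift p i))) N.
have sw' : size w' = N by rewrite size_mkseq.
have shN i : i < N -> shift p i < N.+2 by rewrite /shift; case: ifP; lia.
have w'E i : i < N -> pt w (shift p i) = shift p (pt w' i) /\ pt w' i < N.
  move=> iN; rewrite nth_mkseq //; have [tN tt tn] := wP _ (shN _ iN).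
  case: (insert_arc_cases pN tN) => [t0|t1|[k kN tk]].
  - by move: tt; rewrite t0 pE /shift; case: ifP; lia.
  - by move: tt; rewrite t1 -pE w00 /shift; case: ifP; lia.
  by rewrite tk shiftK.
exists p, w'; split=> //.
  apply/partner_listP => i; rewrite sw' => iN.
  have [E tN] := w'E i iN; have [E' tN'] := w'E _ tN.
  have [_ tt tn] := wP _ (shN _ iN).
  split=> //; first by apply: (@shift_inj p); rewrite -E' -E.
  by move=> Et; apply: tn; rewrite E Et.
apply: (@eq_from_nth _ 0); first by rewrite size_insert_arc sw' sw.
move=> j; rewrite sw => jN.
case: (insert_arc_cases pN jN) => [->|->|[i iN ->]].
- by rewrite nth_insert_arc0.
- by rewrite nth_insert_arc1 ?sw' // -pE.
by rewrite nth_insert_arc ?sw' //; case: (w'E i iN).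
Qed.

Lemma insert_arc_inj p p' w w' : size w = size w' -> p <= size w -> p' <= size w' ->
  insert_arc p w = insert_arc p' w' -> p = p' /\ w = w'.
Proof.
move=> sw pN p'N [<-] /eqP; rewrite eqseq_cat; last first.
  by rewrite !size_take !size_map sw.
rewrite eqseq_cons eqxx /= => /andP[/eqP E1 /eqP E2]; split=> //.
apply: (inj_map (@shift_inj p)).
by rewrite -(cat_take_drop p (map _ w)) E1 E2 cat_take_drop.
Qed.

Fixpoint partner_lists (n : nat) : seq (seq nat) :=
  if n is n'.+1 then
    [seq insert_arc p w | w <- partner_lists n', p <- iota 0 (2 * n').+1]
  else [:: [::]].

Lemma mem_partner_lists n w :
  (w \in partner_lists n) = (size w == 2 * n) && is_partner_list w.
Proof.
elim: n w => [|n IHn] w; first by rewrite inE; case: w.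
apply/allpairsP/andP => [[[w' p] [+ + ->]]|[/eqP sw wP]].
  rewrite IHn mem_iota -[(w', p).1]/w' -[(w', p).2]/p => /andP[/eqP sw' w'P] pN.
  rewrite size_insert_arc sw'; split; first by apply/eqP; lia.
  by apply: insert_arc_partner; rewrite // sw'.
rewrite mulnS in sw; have [p [w' [pN sw' w'P ->]]] := partner_insert_arc sw wP.
by exists (w', p); rewrite IHn mem_iota sw' eqxx.
Qed.

Lemma uniq_partner_lists n : uniq (partner_lists n).
Proof.
elim: n => [|n IHn] //; apply: allpairs_uniq; rewrite ?iota_uniq //.
move=> _ _ /allpairsP[[w p] [+ + ->]] /allpairsP[[w' p'] [+ + ->]].
rewrite !mem_partner_lists !mem_iota /= => /andP[/eqP sw _] pN /andP[/eqP sw' _] p'N.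
by case/insert_arc_inj => [|||-> ->] //; lia.
Qed.

(** The new arc starts first, so it can only be the letter 1 of an occurrence, which is what
    [good_gap] excludes; all other occurrences are shifted from w. *)
Lemma avoider_insert_arc p w : p <= size w ->
  avoider (insert_arc p w) = avoider w && good_gap w p.
Proof.
move=> pN; have sN := size_insert_arc p w.
have nthS i := @nth_insert_arc p w i pN.
have nth1 := @nth_insert_arc1 p w pN; have nth0 := nth_insert_arc0 p w.
(* The closing point p.+1 has partner 0, so it fails every such inequality. *)
have cases j x : x < pt (insert_arc p w) j ->
    j = 0 \/ exists2 i, i < size w & j = shift p i.
  move=> xj; have := nth_gt_size xj; rewrite sN => jN.
  by case: (insert_arc_cases pN jN) xj => [->|->|[i iN ->]]; rewrite ?nth1 //; eauto.
rewrite /avoider -andbA; apply/idP/idP.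
- case/andP => /contains12312P A /contains121323P B; apply/and3P; split.
  + apply/contains12312P=> -[i [j [k [ij jk ki tij kk]]]].
    have [iN jN kN] := And3 (nth_gt_size ki) (nth_gt_size tij) (nth_gt_size kk).
    by apply: A; exists (shift p i), (shift p j), (shift p k); rewrite !nthS ?ltn_shift.
  + apply/contains121323P=> -[i [j [k [ij ji ik kj jk]]]].
    have [iN jN kN] := And3 (nth_gt_size ji) (nth_gt_size kj) (nth_gt_size jk).
    by apply: B; exists (shift p i), (shift p j), (shift p k); rewrite !nthS ?ltn_shift.
  apply/good_gapP; split=> j k.
  + move=> jk kp pj kk; apply: A; exists 0, (shift p j), (shift p k).
    have kN := nth_gt_size kk; have jN : j < size w by lia.
    by rewrite nth0 !nthS // !ltn_shift shift_gt0 ltn_shiftr ltnS shift_leq.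
  + move=> jp pk kj jk; apply: B; exists 0, (shift p j), (shift p k).
    have kN := nth_gt_size jk; have jN := nth_gt_size kj.
    by rewrite nth0 !nthS // !ltn_shift shift_gt0 ltn_shiftr ltnS shift_leq.
case/and3P => /contains12312P A /contains121323P B /good_gapP[C D].
apply/andP; split.
- apply/contains12312P=> -[i [j [k [ij jk ki tij kk]]]].
  case: (cases k _ kk) => [k0|[k' kN Ek]]; first by lia.
  case: (cases j _ tij) => [j0|[j' jN Ej]]; first by lia.
  move: ij jk ki tij kk; rewrite {}Ek {}Ej !nthS // !ltn_shift => ij jk ki tij kk.
  case: (cases i _ ki) => [Ei|[i' iN Ei]]; move: ki tij ij; rewrite {}Ei.
    by rewrite nth0 ltn_shiftr ltnS shift_leq => kp pj _; apply: (C j' k').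
  by rewrite !nthS // !ltn_shift => ki tij ij; apply: A; exists i', j', k'.
apply/contains121323P=> -[i [j [k [ij ji ik kj jk]]]].
case: (cases k _ jk) => [k0|[k' kN Ek]]; first by lia.
case: (cases j _ kj) => [j0|[j' jN Ej]]; first by lia.
move: ij ji ik kj jk; rewrite {}Ek {}Ej !nthS // !ltn_shift => ij ji ik kj jk.
case: (cases i _ ji) => [Ei|[i' iN Ei]]; move: ij ji ik; rewrite {}Ei.
  by rewrite nth0 ltn_shiftr ltnS shift_leq => _ jp pk; apply: (D j' k').
by rewrite !nthS // !ltn_shift => ij ji ik; apply: B; exists i', j', k'.
Qed.

(** The new arc crosses exactly the old arcs that cover the gap p. *)
Lemma crossing_number_insert_arc p w : p <= size w ->
  crossing_number (insert_arc p w) = crossing_number w + open_arcs w p.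
Proof.
move=> pN; rewrite /crossing_number size_insert_arc.
have perm := perm_iota_shift pN.
have inner i : \sum_(j <- iota 0 (size w).+2)
   [&& i < j, j < pt (insert_arc p w) i & pt (insert_arc p w) i < pt (insert_arc p w) j]
   = \sum_(j <- iota 0 (size w))
   [&& i < shift p j, shift p j < pt (insert_arc p w) i &
       pt (insert_arc p w) i < shift p (pt w j)].
  rewrite (perm_big _ perm) /= !big_cons big_map nth_insert_arc1 // !andbF /= add0n.
  rewrite add0n; apply: eq_big_seq => j; rewrite mem_iota => jN.
  by rewrite nth_insert_arc.
under eq_bigr => i _ do rewrite inner.
rewrite (perm_big _ perm) /= !big_cons big_map addnC; congr (_ + _).
  rewrite big1 ?add0n => [|j _]; last by rewrite nth_insert_arc1 // andbF.
  apply: eq_big_seq => i; rewrite mem_iota => iN.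
  by apply: eq_bigr => j _; rewrite nth_insert_arc // !ltn_shift.
rewrite /open_arcs -sum1_count [RHS]big_mkcond /=; apply: eq_bigr => j _.
by rewrite shift_gt0 ltnS shift_leq ltn_shiftr /=; case: andP.
Qed.

(** The successor counts the gap 0. The new arc covers the gaps 1 to p.+1, and a later gap q.+2 is a
    boundary when the old gap q is one. *)
Lemma boundaries_insert_arc p w : p <= size w -> boundaries (insert_arc p w) =
  (count (boundary w) (iota p ((size w).+1 - p))).+1.
Proof.
move=> pN; rewrite /boundaries size_insert_arc.
have -> : (size w).+3 = 1 + (p.+1 + ((size w).+1 - p)) by lia.
rewrite !iotaD !count_cat /= add0n.
rewrite (_ : boundary (insert_arc p w) 0); last by apply/boundaryP.
rewrite [X in _ + (X + _)](_ : _ = 0) ?add0n; last first.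
  apply/eqP; rewrite eqn0Ngt -has_count; apply/hasPn => q; rewrite mem_iota => qp.
  by apply/not_boundaryP; exists 0; rewrite ?nth_insert_arc0; lia.
rewrite (_ : 1 + p.+1 = 2 + p) // iotaDl count_map; apply: (congr1 S).
apply: eq_in_count => q; rewrite mem_iota => qN /=.
apply/boundaryP/boundaryP => H i iq qi.
  have /(@nth_gt_size w i) iN : i < pt w i by lia.
  apply: (H (shift p i)); rewrite ?nth_insert_arc // /shift; case: ifP; lia.
have /(@nth_gt_size _ i) : i < pt (insert_arc p w) i by lia.
rewrite size_insert_arc => /(insert_arc_cases pN).
case=> [Ei|Ei|[j jN Ei]]; move: iq qi; rewrite {}Ei.
- by rewrite nth_insert_arc0; lia.
- by rewrite nth_insert_arc1.
rewrite nth_insert_arc // => jq qj; apply: (H j).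
  by move: jq; rewrite /shift; case: ifP; lia.
by move: qj; rewrite /shift; case: ifP; lia.
Qed.

(** As p runs through the elements of P, the number of elements from p on takes each value from 1 to
    their total once. *)
Lemma sum_count_iota (P : pred nat) (h : nat -> nat) s M :
  \sum_(p <- iota s M | P p) h (count P (iota p (s + M - p))) =
  \sum_(1 <= j < (count P (iota s M)).+1) h j.
Proof.
elim: M s => [|M IHM] s; first by rewrite big_nil big_geq.
rewrite [iota s M.+1]/= big_cons [count P (s :: _)]/=.
have -> : s + M.+1 - s = M.+1 by lia.
have -> : \sum_(p <- iota s.+1 M | P p) h (count P (iota p (s + M.+1 - p))) =
          \sum_(1 <= j < (count P (iota s.+1 M)).+1) h j.
  by rewrite -IHM; apply: eq_bigr => p _; rewrite addSnnS.
by rewrite [iota s _]/= [count P (s :: _)]/=; case: (P s); rewrite ?add1n ?add0n //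
  [RHS]big_nat_recr //= addnC.
Qed.

(** * The good gaps of an avoider *)

Section Sites.

Variable w : seq nat.
Hypotheses (wP : is_partner_list w) (w_av : avoider w).
Local Notation N := (size w).

Let t_ltn i : i < N -> pt w i < N.
Proof. by move=> iN; case: (partner_listP w wP i iN). Qed.

Let tK i : i < N -> pt w (pt w i) = i.
Proof. by move=> iN; case: (partner_listP w wP i iN). Qed.

Let t_neq i : i < N -> pt w i <> i.
Proof. by move=> iN; case: (partner_listP w wP i iN). Qed.

Let av1 i j k :
  i < j -> j < k -> k < pt w i -> pt w i < pt w j -> k < pt w k -> False.
Proof.
by move=> *; case/andP: w_av => /contains12312P + _; apply; exists i, j, k.
Qed.

Let av2 i j k : i < j -> j < pt w i -> pt w i < k -> k < pt w j ->
  pt w j < pt w k -> False.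
Proof.
by move=> *; case/andP: w_av => _ /contains121323P; apply; exists i, j, k.
Qed.

(* The unique gap of the component starting at a where a new first arc can end
   while crossing an old arc. *)
Definition site (a : nat) : nat :=
  if has (fun j => [&& a < j, j < pt w a & pt w a < pt w j]) (iota 0 N)
  then (pt w a).+1 else a.+1.

Variant site_spec a : nat -> Type :=
| SiteCrossed j of a < j & j < pt w a & pt w a < pt w j :
    site_spec a (pt w a).+1
| SiteUncrossed of (forall j, a < j -> j < pt w a -> pt w a < pt w j -> False) :
    site_spec a a.+1.

Lemma siteP a : site_spec a (site a).
Proof.
rewrite /site; case: hasP => [H|H].
  have [j _ /and3P[aj ja tj]] := sig2W H.
  exact: SiteCrossed aj ja tj.
apply: SiteUncrossed => j aj ja tj; apply: H.
by exists j; rewrite ?mem_iota ?(nth_gt_size tj) // aj ja.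
Qed.

Lemma boundary_opener a : a < N -> boundary w a -> a < pt w a.
Proof.
move=> aN /boundaryP bd; have := t_neq aN; have := tK aN.
by case: (ltngtP (pt w a) a) => // ta tta _; case: (bd _ ta); lia.
Qed.

(** Two arcs crossing that of a would form 12312 with it, the later one giving the letter 3. *)
Lemma open_after_crossed a j u : a < N -> boundary w a ->
  a < j -> j < pt w a -> pt w a < pt w j ->
  u <= pt w a -> pt w a < pt w u -> u = j.
Proof.
move=> aN /boundaryP bd aj ja tj ua tu.
have tta := tK aN.
have ua' : a < u.
  case: (ltngtP u a) => // [lt|E]; first by case: (bd u lt); lia.
  by move: tu; rewrite E; lia.
have uta : u < pt w a.
  by case: (ltngtP u (pt w a)) ua => // E _; move: tu; rewrite E tta; lia.
case: (ltngtP u j) => // lt.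
  by case: (@av1 a u j); lia.
by case: (@av1 a j u); lia.
Qed.

Lemma site_bounds a : a < N -> boundary w a -> a < site a <= N.
Proof.
move=> aN bd; have := boundary_opener aN bd; have := t_ltn aN.
by case: siteP => *; lia.
Qed.

Lemma site_not_boundary a q : a < N -> boundary w a -> a < q <= site a ->
  ~~ boundary w q.
Proof.
move=> aN bd; have ta := boundary_opener aN bd; have tN := t_ltn aN.
case: siteP => [j aj ja tj|nc] aq; apply/not_boundaryP.
  by case: (leqP q (pt w a)) => qa; [exists a | exists j]; lia.
by exists a; lia.
Qed.

(** The site is covered by one old arc only. If this is the arc of j, a violation gives 12312 or
    121323 together with the arc of a; if it is the arc of a, a violation needs an arc over the
    boundary a or one crossing that of a. *)
Lemma site_good a : a < N -> boundary w a -> good_gap w (site a).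
Proof.
move=> aN bd; have ta := boundary_opener aN bd; have tta := tK aN.
have bdP := boundaryP _ _ bd.
case: siteP => [j aj ja tj|nc]; apply/good_gapP; split=> i k.
- move=> ik ka ai kk.
  have E : i = j by apply: (open_after_crossed aN bd aj ja tj); lia.
  have kta : k <> pt w a by move=> E'; move: kk; rewrite E' tta; lia.
  by case: (@av1 a j k); lia.
- move=> ia ak ki tik.
  have E : i = j by apply: (open_after_crossed aN bd aj ja tj); lia.
  by subst i; case: (@av2 a j k); lia.
- by move=> ik ka ai kk; apply: (bdP i); lia.
move=> ia ak ki tik; case: (ltngtP i a) => [lt|gt|E].
- by apply: (bdP i); lia.
- by lia.
by subst i; apply: (nc k); lia.
Qed.

Lemma good_gap_site p : p <= N -> good_gap w p -> ~~ boundary w p ->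
  exists2 a, (a < N) && boundary w a & p = site a.
Proof.
move=> pN /good_gapP[gA gB] nbd.
have p_gt0 : 0 < p by case/not_boundaryP: nbd => i; lia.
have ex0 : exists a, (a < p) && boundary w a by exists 0; rewrite p_gt0; apply/boundaryP.
have ub a : (a < p) && boundary w a -> a <= p by lia.
(* The component is the one that starts at the last boundary before p. *)
case: (ex_maxnP ex0 ub) => a /andP[ap bd] amax.
have aN : a < N by lia.
exists a; first by rewrite aN.
have inner q : a < q <= p -> exists2 i, i < q & q <= pt w i.
  move=> /andP[aq qp]; apply/not_boundaryP.
  case: (ltngtP q p) => [lt|gt|->] //; last by lia.
  by apply/negP=> bq; have := amax q; rewrite lt bq; lia.
have ta := boundary_opener aN bd; have tta := tK aN; have tN := t_ltn aN.
have bdP := boundaryP _ _ bd.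
case: siteP => [j aj ja tj|nc].
  have jN := nth_gt_size tj; have ttj := tK jN.
  have uniq_open u : u <= pt w a -> pt w a < pt w u -> u = j.
    exact: (open_after_crossed aN bd aj ja tj).
  case: (leqP p (pt w a)) => pa.
    (* Under the arc of a, the crossing arc of j violates one of the two conditions, according to
       the side of p on which it starts. *)
    by case: (ltnP j p) => jp; [case: (gA a j) | case: (gB a j)]; lia.
  case: (ltngtP p (pt w a).+1) => // pta; first by lia.
  (* If p is still under the arc of j, the point after pt w a violates the first condition when it
     is initial; otherwise its arc would be that of j, which ends too late. *)
  case: (leqP p (pt w j)) => ptj.
    have sN : (pt w a).+1 < N by lia.
    have tts := tK sN; have ts := t_neq sN.
    case: (ltngtP (pt w a).+1 (pt w (pt w a).+1)) => [lt|gt|E]; last by lia.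
      by case: (gA j (pt w a).+1); lia.
    have E : pt w (pt w a).+1 = j by apply: uniq_open; lia.
    by move: tts; rewrite E; lia.
  (* Beyond the arc of j, the gap right after its end is covered by some arc d, which gives 121323
     with a and j. *)
  have [d dq qd] := inner (pt w j).+1 ltac:(lia).
  have dj : d <> pt w j by move=> E; move: qd; rewrite E; lia.
  case: (leqP d (pt w a)) => da.
    have E : d = j by apply: uniq_open; lia.
    by move: qd; rewrite E; lia.
  by case: (@av2 a j d); lia.
(* With the arc of a uncrossed, a gap after a.+1 either has the arc starting at a.+1 nested or
   crossing before it, or lies beyond pt w a, where no arc can continue the component. *)
case: (ltngtP p a.+1) => // pa; first by lia.
case: (leqP p (pt w a)) => pta.
  have cN : a.+1 < N by lia.
  have ttc := tK cN; have tc := t_neq cN.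
  case: (ltngtP a.+1 (pt w a.+1)) => [lt|gt|E]; last by lia.
    by case: (gA a a.+1); lia.
  case: (ltngtP (pt w a.+1) a) => [lt|gt'|E]; last by move: ttc; rewrite E; lia.
    by case: (bdP _ lt); lia.
  by lia.
have [d dq qd] := inner (pt w a).+1 ltac:(lia).
have da : d <> pt w a by move=> E; move: qd; rewrite E; lia.
case: (ltngtP d a) => [lt|gt|E]; last by move: qd; rewrite E; lia.
  by case: (bdP _ lt); lia.
by case: (nc d); lia.
Qed.

(** Of two arcs covering p, the later one would violate the first condition of [good_gap]. *)
Lemma good_gap_open_arcs p :
  good_gap w p -> ~~ boundary w p -> open_arcs w p = 1.
Proof.
move=> /good_gapP[gA _] /not_boundaryP[i ip pi].
have iN : i < N by apply: (@nth_gt_size w i i); lia.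
rewrite /open_arcs (@eq_in_count _ _ (pred1 i)).
  by rewrite count_uniq_mem ?iota_uniq // mem_iota iN.
move=> j; rewrite mem_iota => jN /=; apply/idP/eqP => [/andP[jp pj]|->]; last by rewrite ip.
by case: (ltngtP j i) => // lt; [case: (gA j i) | case: (gA i j)]; lia.
Qed.

Lemma boundary_good_gap p : boundary w p -> good_gap w p.
Proof.
move/boundaryP=> bd; apply/good_gapP; split=> j k.
  by move=> jk kp pj _; apply: (bd j); lia.
by move=> jp pk kj _; apply: (bd j); lia.
Qed.

Lemma boundary_size : boundary w N.
Proof.
apply/boundaryP => i iN; have := t_ltn iN; lia.
Qed.

(** Starting from the site instead of a loses the boundary a alone; this is balanced by leaving out
    the last boundary N on the right. *)
Lemma count_boundary_site a : a < N -> boundary w a ->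
  count (boundary w) (iota (site a) (N.+1 - site a)) =
  count (boundary w) (iota a (N - a)).
Proof.
move=> aN bd; have /andP[lt le] := site_bounds aN bd.
have E1 : N.+1 - a = (N - a) + 1 by lia.
have E2 : N.+1 - a = 1 + ((site a - a.+1) + (N.+1 - site a)) by lia.
(* One count is split in two ways: before the gap N, and after a and before its site. *)
have : count (boundary w) (iota a (N.+1 - a)) = count (boundary w) (iota a (N.+1 - a)) by [].
rewrite {1}E1 E2 !iotaD !count_cat /= bd.
rewrite (_ : a + (N - a) = N) ?boundary_size; last lia.
rewrite (_ : a + 1 + (site a - a.+1) = site a); last lia.
rewrite [X in _ = _ + (X + _)](_ : _ = 0); first by lia.
apply/eqP; rewrite eqn0Ngt -has_count; apply/hasPn => q; rewrite mem_iota => qb.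
by apply: (site_not_boundary aN bd); lia.
Qed.

Lemma perm_sites :
  perm_eq [seq p <- iota 0 N.+1 | good_gap w p && ~~ boundary w p]
          [seq site a | a <- iota 0 N & boundary w a].
Proof.
apply: uniq_perm; first by rewrite filter_uniq ?iota_uniq.
  rewrite map_inj_in_uniq ?filter_uniq ?iota_uniq // => a b.
  rewrite !mem_filter !mem_iota => /andP[ba /andP[_ aN]] /andP[bb /andP[_ bN]] E.
  have := site_bounds aN ba; have := site_bounds bN bb.
  case: (ltngtP a b) => // lt Bb Ba.
    by have := @site_not_boundary a b aN ba ltac:(lia); rewrite bb.
  by have := @site_not_boundary b a bN bb ltac:(lia); rewrite ba.
move=> p; rewrite mem_filter mem_iota; apply/idP/mapP.
  case/andP=> /andP[gp nb] pN; have [|a /andP[aN ba] ->] := good_gap_site _ gp nb.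
    by lia.
  by exists a; rewrite // mem_filter ba mem_iota.
case=> a; rewrite mem_filter mem_iota => /andP[ba /andP[_ aN]] ->.
have Ba := site_bounds aN ba.
by rewrite site_good // (@site_not_boundary a) //; lia.
Qed.

(** The succession rule of the generating tree, for any function g of the numbers of new crossings
    and resulting boundaries. *)
Lemma sum_good_gaps (g : nat -> nat -> nat) :
  \sum_(p <- iota 0 N.+1 | good_gap w p)
     g (open_arcs w p) (boundaries (insert_arc p w)) =
  \sum_(2 <= j < (boundaries w).+2) g 0 j + \sum_(2 <= j < (boundaries w).+1) g 1 j.
Proof.
have bN : boundaries w = (count (boundary w) (iota 0 N)).+1.
  by rewrite /boundaries -addn1 iotaD count_cat /= add0n boundary_size addn0 addn1.
rewrite (bigID (boundary w)); congr (_ + _).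
  rewrite big_add1 -pred_Sn -(sum_count_iota (boundary w) (fun j => g 0 j.+1) 0).
  rewrite big_seq_cond [RHS]big_seq_cond; apply: eq_big => p.
    by case bp: (boundary w p); rewrite ?andbF ?andbT // boundary_good_gap ?andbT.
  case/and3P; rewrite mem_iota => /andP[_ pN] _ bp.
  by rewrite boundaries_insert_arc ?add0n // (eqP bp).
rewrite -big_filter (perm_big _ perm_sites) big_map big_filter bN big_add1 -pred_Sn.
rewrite -(sum_count_iota (boundary w) (fun j => g 1 j.+1) 0).
rewrite big_seq_cond [RHS]big_seq_cond; apply: eq_bigr => a.
rewrite mem_iota => /andP[/andP[_ aN] ba].
have Ba := site_bounds aN ba.
rewrite boundaries_insert_arc; last lia.
rewrite good_gap_open_arcs ?site_good ?(@site_not_boundary a) //; last lia.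
by rewrite count_boundary_site ?add0n.
Qed.

End Sites.

(** * Counting along the generating tree *)

(* Like [descendants], with m the total number of crossings wanted and c the
   number of those already present. *)
Definition pending (k m c b : nat) : nat := if c <= m then descendants k (m - c) b else 0.

Lemma pendingS k m c b : pending k.+1 m c b =
  \sum_(2 <= j < b.+2) pending k m c j + \sum_(2 <= j < b.+1) pending k m c.+1 j.
Proof.
rewrite /pending; case: (ltngtP c m) => [lt|gt|->].
- rewrite /descendants -/descendants; congr (_ + _).
  by rewrite (_ : m - c = (m - c.+1).+1); last lia.
- by rewrite !big1.
by rewrite subnn /descendants -/descendants [X in _ = _ + X]big1.
Qed.

(** The last insertion made becomes one still to come; iterating this leads back to the empty
    matching, which has one boundary. *)
Lemma sum_pendingS n k m :
  \sum_(w <- partner_lists n.+1 | avoider w) pending k m (crossing_number w) (boundaries w) =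
  \sum_(w <- partner_lists n | avoider w) pending k.+1 m (crossing_number w) (boundaries w).
Proof.
rewrite big_mkcond big_allpairs_dep [RHS]big_mkcond big_seq_cond [RHS]big_seq_cond.
apply: eq_bigr => w; rewrite andbT mem_partner_lists => /andP[/eqP sw wP].
rewrite -sw big_seq_cond.
under eq_bigr => p.
  rewrite andbT mem_iota => /andP[_ pN].
  rewrite avoider_insert_arc // crossing_number_insert_arc //.
over.
rewrite -big_seq_cond; case: ifP => /= av; last by rewrite big1.
rewrite -big_mkcond /= pendingS.
rewrite (sum_good_gaps wP av (fun o b => pending k m (crossing_number w + o) b)).
by rewrite addn0 addn1.
Qed.

Lemma count_avoiders n m :
  count (fun w => avoider w && (crossing_number w == m)) (partner_lists n) =
  descendants n m 1.
Proof.
transitivity (\sum_(w <- partner_lists n | avoider w)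
                pending 0 m (crossing_number w) (boundaries w)).
  rewrite -sum1_count big_mkcondr; apply: eq_bigr => w _.
  by rewrite /pending /descendants; case: (ltngtP (crossing_number w) m); lia.
have gen k : \sum_(w <- partner_lists n | avoider w)
    pending k m (crossing_number w) (boundaries w) = pending (n + k) m 0 1.
  elim: n k => [|n IHn] k; last by rewrite sum_pendingS IHn addSnnS.
  by rewrite big_cons big_nil (_ : avoider [::]) //= addn0 /crossing_number big_nil.
by rewrite gen /pending addn0 subn0.
Qed.

(** * Matchings as partner lists *)

Lemma bigminn_leq (I : eqType) (s : seq I) (P : pred I) (F : I -> nat) N y :
  y \in s -> P y -> \big[minn/N]_(x <- s | P x) F x <= F y.
Proof.
elim: s => // x s IHs; rewrite inE big_cons => /predU1P[<-|ys] Py.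
  by rewrite Py geq_minl.
by case: ifP => _; [apply: leq_trans (geq_minr _ _) _|]; apply: IHs.
Qed.

Lemma initial_point_set2 N (i j : 'I_N) : initial_point [set i; j] = minn i j.
Proof.
apply/eqP; rewrite eqn_leq leq_min /initial_point.
rewrite !bigminn_leq ?mem_index_enum ?set21 ?set22 //=.
apply: (big_ind (fun v => minn i j <= v)) => [|x y xm ym|x].
- by rewrite geq_min ltnW.
- by rewrite leq_min xm.
by rewrite !inE => /orP[]/eqP->; rewrite ?geq_minl ?geq_minr.
Qed.

(** The sets counted by the labels are nested, and f itself separates them when the inequality is
    strict. *)
Lemma edge_label_ltn N (M : {set {set 'I_N}}) e f : f \in M ->
  (edge_label M e < edge_label M f) = (initial_point e < initial_point f).
Proof.
move=> fM; rewrite /edge_label; case: (ltnP (initial_point e)) => ef.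
  apply: proper_card; apply/properP; split.
    by apply/subsetP => g; rewrite !inE => /andP[-> /leq_trans->] //; apply: ltnW.
  by exists f; rewrite !inE fM ?leqnn // -ltnNge.
apply/negbTE; rewrite -leqNgt; apply: subset_leq_card; apply/subsetP => g.
by rewrite !inE => /andP[-> /leq_trans->].
Qed.

(** Bit masks are traded for increasing lists of positions, which can be named one by one. *)
Lemma word_containsP (w tau : seq nat) : reflect
  (exists ps, [/\ sorted ltn ps, all (gtn (size w)) ps, size ps = size tau &
     forall i j, i < size tau -> j < size tau ->
       (pt w (pt ps i) < pt w (pt ps j)) = (pt tau i < pt tau j)])
  (word_contains w tau).
Proof.
have maskE (s : bitseq) : mask s w = map (pt w) (mask s (iota 0 (size w))).
  by rewrite map_mask map_nth_iota0 // take_size.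
apply: (iffP existsP) => [[s /andP[/eqP ss /forallP iso]]|[ps [ps_sort ps_lt ps_size iso]]].
  exists (mask s (iota 0 (size w))); split.
  - by rewrite (subseq_sorted ltn_trans (mask_subseq _ _)) // iota_ltn_sorted.
  - by apply/allP => x /mem_mask; rewrite mem_iota.
  - by rewrite -ss [in RHS]maskE size_map.
  rewrite -ss => i j iN jN; move/forallP: (iso (Ordinal iN)) => /(_ (Ordinal jN)) /eqP /= <-.
  have sE : size (mask s w) = size (mask s (iota 0 (size w))) by rewrite maskE size_map.
  by rewrite [mask s w]maskE !(nth_map 0) // -sE.
have psE : mask (map (mem ps) (iota 0 (size w))) (iota 0 (size w)) = ps.
  rewrite -filter_mask; apply: (irr_sorted_eq ltn_trans ltnn) => //.
    by apply: sorted_filter; [exact: ltn_trans | exact: iota_ltn_sorted].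
  move=> x; rewrite mem_filter mem_iota /= andbC; apply/andb_idl => /(allP ps_lt).
  by [].
have sz : size (map (mem ps) (iota 0 (size w))) == size w by rewrite size_map size_iota.
exists (Tuple sz); rewrite /order_isomorphic /= maskE psE size_map ps_size eqxx /=.
apply/forallP => i; apply/forallP => j; rewrite !(nth_map 0) ?ps_size //.
by rewrite iso.
Qed.

Definition partner N (w : seq nat) (i : 'I_N) : 'I_N := insubd i (pt w i).

Definition arc N (w : seq nat) (i : 'I_N) : {set 'I_N} := [set i; partner w i].

Definition matching_of N (w : seq nat) : {set {set 'I_N}} :=
  [set arc w i | i : 'I_N].

Section Bridge.

Variables (N : nat) (w : seq nat).
Hypotheses (sw : size w = N) (wP : is_partner_list w).
Local Notation t := (@partner N w).
Local Notation arc := (@arc N w).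
Local Notation M := (matching_of N w).

Lemma partnerE (i : 'I_N) : t i = pt w i :> nat.
Proof.
rewrite val_insubd; have := partner_listP w wP i; rewrite sw => /(_ (ltn_ord i)).
by case=> ->.
Qed.

Lemma partnerK : involutive t.
Proof.
move=> i; apply: val_inj; rewrite /= !partnerE.
by have := partner_listP w wP i; rewrite sw => /(_ (ltn_ord i)) [].
Qed.

Lemma partner_neq (i : 'I_N) : t i != i.
Proof.
apply/eqP => /(congr1 val); rewrite /= partnerE.
by have := partner_listP w wP i; rewrite sw => /(_ (ltn_ord i)) [].
Qed.

Lemma arc_eq i j : i \in arc j -> arc i = arc j.
Proof. by rewrite !inE => /orP[]/eqP-> //; rewrite /arc partnerK setUC. Qed.

Lemma arc_in i : arc i \in M.
Proof. exact: imset_f. Qed.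

Lemma mem_arc i : i \in arc i.
Proof. exact: set21. Qed.

Lemma arc_of_mem e i : e \in M -> i \in e -> e = arc i.
Proof. by case/imsetP => j _ -> /arc_eq. Qed.

Lemma matching_of_matching : partition M [set: 'I_N] && [forall e in M, #|e| == 2].
Proof.
apply/andP; split; last first.
  by apply/forall_inP => _ /imsetP[i _ ->]; rewrite cards2 (eq_sym i) partner_neq.
apply/and3P; split.
- rewrite eqEsubset subsetT; apply/subsetP => i _; apply/bigcupP.
  by exists (arc i); rewrite ?arc_in ?mem_arc.
- apply/trivIsetP => _ _ /imsetP[i _ ->] /imsetP[j _ ->]; apply: contraR => /pred0Pn[k].
  by case/andP => /= /arc_eq <- /arc_eq <-.
by apply/imsetP => -[i _ E]; have := mem_arc i; rewrite -E inE.
Qed.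

Lemma pblock_matching_of i : pblock M i = arc i.
Proof.
apply: def_pblock; rewrite ?arc_in ?mem_arc //.
by case/andP: matching_of_matching => /and3P[].
Qed.

Lemma size_canonical_form : size (canonical_form M) = N.
Proof. by rewrite size_map size_enum_ord. Qed.

Lemma canonical_form_ltn i j : i < N -> j < N ->
  (pt (canonical_form M) i < pt (canonical_form M) j) =
  (minn i (pt w i) < minn j (pt w j)).
Proof.
have cfE (k : 'I_N) : pt (canonical_form M) k = edge_label M (arc k).
  rewrite /canonical_form (nth_map k) ?size_enum_ord // nth_ord_enum.
  by rewrite pblock_matching_of.
move=> iN jN; rewrite (cfE (Ordinal iN)) (cfE (Ordinal jN)) edge_label_ltn ?arc_in //.
by rewrite !initial_point_set2 !partnerE.
Qed.

Let tK i : i < N -> pt w (pt w i) = i.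
Proof. by have := partner_listP w wP i; rewrite sw => H /H[]. Qed.

Let t_ltn i : i < N -> pt w i < N.
Proof. by have := partner_listP w wP i; rewrite sw => H /H[]. Qed.

Lemma same_letter i j : i < j -> j < N ->
  minn i (pt w i) = minn j (pt w j) -> pt w i = j.
Proof.
move=> ij jN E; have iN : i < N by lia.
have ti := tK iN; have tj := tK jN.
have [E'|E'] : pt w j = i \/ pt w i = pt w j by lia.
  by rewrite -tj E'.
by move: ij; rewrite -ti E' tj ltnn.
Qed.

Lemma avoids12312 : avoids M [:: 1; 2; 3; 1; 2] = ~~ contains12312 w.
Proof.
congr (~~ _); apply/word_containsP/contains12312P.
  rewrite size_canonical_form => -[ps [so lt sz iso]].
  case: ps so lt sz iso => [|p1 [|p2 [|p3 [|p4 [|p5 [|]]]]]] //=.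
  case/and5P=> l12 l23 l34 l45 _ /and5P[n1 n2 n3 n4 /andP[n5 _]] _ iso.
  have := iso 0 1 isT isT; have := iso 1 2 isT isT.
  have := iso 0 3 isT isT; have := iso 3 0 isT isT.
  have := iso 1 4 isT isT; have := iso 4 1 isT isT.
  rewrite /= !canonical_form_ltn // => e1 e2 e3 e4 e5 e6.
  have E1 : pt w p1 = p4 by apply: same_letter; lia.
  have E2 : pt w p2 = p5 by apply: same_letter; lia.
  (* The letter 3 may be read at the end of its arc; then the initial point pt w p3 replaces p3, and
     it lies after p2 because its label is larger. *)
  case: (ltnP p3 (pt w p3)) => l3; first by exists p1, p2, p3; split; lia.
  have t3 := tK n3; exists p1, p2, (pt w p3); split; try lia.
  rewrite t3; case: (ltngtP (pt w p3) p3) => //; first by lia.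
  have := partner_listP w wP p3; rewrite sw => /(_ n3) []; lia.
case=> i [j [k [ij jk ki tij kk]]].
have kN := nth_gt_size kk; have jN := nth_gt_size tij; have iN := nth_gt_size ki.
rewrite sw in kN jN iN.
exists [:: i; j; k; pt w i; pt w j]; rewrite size_canonical_form; split=> //.
- by rewrite /= ij jk ki tij.
- by rewrite /= iN jN kN !t_ltn.
have ti := tK iN; have tj := tK jN; have lti := t_ltn iN; have ltj := t_ltn jN.
by case=> [|[|[|[|[|a]]]]]; case=> [|[|[|[|[|b]]]]] //= _ _;
  rewrite canonical_form_ltn ?ti ?tj //; lia.
Qed.

Lemma avoids121323 : avoids M [:: 1; 2; 1; 3; 2; 3] = ~~ contains121323 w.
Proof.
congr (~~ _); apply/word_containsP/contains121323P.
  rewrite size_canonical_form => -[ps [so lt sz iso]].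
  case: ps so lt sz iso => [|p1 [|p2 [|p3 [|p4 [|p5 [|p6 [|]]]]]]] //=.
  case/and5P=> l12 l23 l34 l45 /andP[l56 _] /and5P[n1 n2 n3 n4 /and3P[n5 n6 _]] _ iso.
  have := iso 0 2 isT isT; have := iso 2 0 isT isT.
  have := iso 1 4 isT isT; have := iso 4 1 isT isT.
  have := iso 3 5 isT isT; have := iso 5 3 isT isT.
  rewrite /= !canonical_form_ltn // => e1 e2 e3 e4 e5 e6.
  have E1 : pt w p1 = p3 by apply: same_letter; lia.
  have E2 : pt w p2 = p5 by apply: same_letter; lia.
  have E3 : pt w p4 = p6 by apply: same_letter; lia.
  by exists p1, p2, p4; split; lia.
case=> i [j [k [ij ji ik kj jk]]].
have kN := nth_gt_size jk; have jN := nth_gt_size kj; have iN := nth_gt_size ji.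
rewrite sw in kN jN iN.
exists [:: i; j; pt w i; k; pt w j; pt w k]; rewrite size_canonical_form; split=> //.
- by rewrite /= ij ji ik kj jk.
- by rewrite /= iN jN kN !t_ltn.
have ti := tK iN; have tj := tK jN; have tk := tK kN.
have lti := t_ltn iN; have ltj := t_ltn jN; have ltk := t_ltn kN.
by case=> [|[|[|[|[|[|a]]]]]]; case=> [|[|[|[|[|[|b]]]]]] //= _ _;
  rewrite canonical_form_ltn ?ti ?tj ?tk //; lia.
Qed.

Lemma opener_arc_inj (i j : 'I_N) : i < t i -> j < t j -> arc i = arc j -> i = j.
Proof.
move=> oi oj E; have := mem_arc i; rewrite E !inE => /orP[]/eqP // Ei.
by move: oi oj; rewrite Ei partnerK; lia.
Qed.

Lemma arc_set2 (i j : 'I_N) e : e \in M -> e = [set i; j] -> i != j ->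
  e = arc i /\ j = t i.
Proof.
move=> eM E ij; have Ei : e = arc i by apply: arc_of_mem; rewrite // E set21.
split=> //; have : j \in arc i by rewrite -Ei E set22.
by rewrite !inE eq_sym (negbTE ij) => /eqP.
Qed.

(** An unordered crossing pair corresponds to its two initial points in increasing order; the order
    rules out a swap, whence injectivity. *)
Lemma crossings_matching_of : crossings M = crossing_number w.
Proof.
pose X := [set x : 'I_N * 'I_N | [&& x.1 < x.2, x.2 < t x.1 & t x.1 < t x.2]].
have -> : crossing_number w = #|X|.
  have iotaE : iota 0 N = index_iota 0 N by rewrite /index_iota subn0.
  transitivity (\sum_(i < N) \sum_(j < N)
                  ([&& i < j, j < pt w i & pt w i < pt w j] : nat)).
    by rewrite /crossing_number sw iotaE big_mkord; apply: eq_bigr => i _; rewrite big_mkord.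
  rewrite -sum1_card.
  rewrite pair_big [RHS]big_mkcond; apply: eq_bigr => x _.
  by rewrite inE !partnerE; case: [&& _, _ & _].
rewrite /crossings -(card_in_imset (f := fun x => [set arc x.1; arc x.2])).
  apply: eq_card => P; rewrite inE; apply/exists_inP/imsetP.
    case=> e eM /exists_inP[f fM /andP[/eqP-> /existsP[i /existsP[j /existsP[i' /existsP[j']]]]]].
    case/and3P=> /eqP Ee /eqP Ef ord.
    have [-> Ej] : e = arc i /\ j = t i by apply: arc_set2 => //; apply/eqP=> E; subst; lia.
    have [-> Ej'] : f = arc i' /\ j' = t i' by apply: arc_set2 => //; apply/eqP=> E; subst; lia.
    subst j j'; case/orP: ord => ord; first by exists (i, i'); rewrite ?inE.
    by exists (i', i); rewrite ?inE //= setUC.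
  case=> -[i j]; rewrite inE /= => ord ->; exists (arc i); rewrite ?arc_in //.
  apply/exists_inP; exists (arc j); rewrite ?arc_in // eqxx /=.
  apply/existsP; exists i; apply/existsP; exists (t i).
  by apply/existsP; exists j; apply/existsP; exists (t j); rewrite !eqxx ord.
move=> [i j] [i' j']; rewrite !inE /= => /and3P[ij ji tij] /and3P[ij' ji' tij'] E.
have inj := opener_arc_inj.
have : arc i \in [set arc i'; arc j'] by rewrite -E set21.
have : arc j \in [set arc i'; arc j'] by rewrite -E set22.
rewrite !inE => /orP[]/eqP/inj Ej /orP[]/eqP/inj Ei.
- by move: (Ej ltac:(lia) ltac:(lia)) (Ei ltac:(lia) ltac:(lia)) => ? ?; subst; lia.
- by move: (Ej ltac:(lia) ltac:(lia)) (Ei ltac:(lia) ltac:(lia)) => ? ?; subst; lia.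
- by rewrite (Ej ltac:(lia) ltac:(lia)) (Ei ltac:(lia) ltac:(lia)).
by move: (Ej ltac:(lia) ltac:(lia)) (Ei ltac:(lia) ltac:(lia)) => ? ?; subst; lia.
Qed.

End Bridge.

Lemma matching_of_inj N w w' : size w = N -> is_partner_list w ->
  size w' = N -> is_partner_list w' ->
  matching_of N w = matching_of N w' -> w = w'.
Proof.
move=> sw wP sw' wP' E; apply: (@eq_from_nth _ 0); first by rewrite sw.
rewrite sw => i iN; pose k := Ordinal iN.
have := pblock_matching_of sw wP k; rewrite E (pblock_matching_of sw' wP') => Ek.
have : partner w k \in arc w' k by rewrite Ek set22.
rewrite !inE (negbTE (partner_neq sw wP k)) => /eqP/(congr1 val) /=.
by rewrite !partnerE.
Qed.

Lemma matching_of_surj N (M : {set {set 'I_N}}) :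
  partition M [set: 'I_N] && [forall e in M, #|e| == 2] ->
  exists w, [/\ size w = N, is_partner_list w & M = matching_of N w].
Proof.
case/andP=> /and3P[/eqP cov triv nz] /forall_inP card2.
have inM i : pblock M i \in M by apply: pblock_mem; rewrite cov inE.
have memb i : i \in pblock M i by rewrite mem_pblock cov inE.
(* The other point of the block of i. *)
pose t i := odflt i [pick j in pblock M i | j != i].
have tP i : pblock M i = [set i; t i] /\ t i != i.
  have /cards2P[x [y [xy E]]] := card2 _ (inM i).
  have [j ij Ej] : exists2 j, j != i & pblock M i = [set i; j].
    have := memb i; rewrite E !inE => /orP[]/eqP->; first by exists y; rewrite 1?eq_sym.
    by exists x; rewrite // setUC.
  rewrite /t; case: pickP => [k /andP[kb ki]|/(_ j)]; last by rewrite Ej set22 ij.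
  by move: kb; rewrite Ej !inE (negbTE ki) /= => /eqP <-.
have tK i : t (t i) = i.
  have [Ei ni] := tP i; have [Eti _] := tP (t i).
  have Eb : pblock M (t i) = pblock M i.
    by apply: def_pblock; rewrite ?inM // Ei set22.
  have : i \in pblock M (t i) by rewrite Eb.
  by rewrite Eti !inE eq_sym (negbTE ni) => /eqP.
pose w := [seq val (t i) | i <- enum 'I_N].
have sw : size w = N by rewrite size_map size_enum_ord.
have wE (i : 'I_N) : pt w i = t i.
  by rewrite (nth_map i) ?size_enum_ord // nth_ord_enum.
have wP : is_partner_list w.
  apply/partner_listP => i; rewrite sw => iN.
  rewrite (wE (Ordinal iN)) wE tK; split=> //.
  by have [_ /eqP n] := tP (Ordinal iN) => E; apply: n; apply: val_inj.
exists w; split=> //.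
have arcE i : arc w i = pblock M i.
  by rewrite (tP i).1; congr [set _; _]; apply: val_inj; rewrite /= partnerE.
apply/setP => e; apply/idP/imsetP => [eM|[i _ ->]]; last by rewrite arcE.
have /set0Pn[i ie] : e != set0 by apply: contraNneq nz => <-.
by exists i; rewrite ?arcE // (def_pblock triv eM).
Qed.

Lemma card_matchings n m :
  #|[set M : {set {set 'I_(2 * n)}} |
       [&& is_matching M, avoids M [:: 1; 2; 3; 1; 2],
           avoids M [:: 1; 2; 1; 3; 2; 3] & crossings M == m]]| = descendants n m 1.
Proof.
rewrite -count_avoiders -size_filter.
set s := filter _ _.
have sP w : w \in s -> [/\ size w = 2 * n, is_partner_list w, avoider w
                         & crossing_number w = m].
  rewrite mem_filter mem_partner_lists.
  by case/andP => /andP[av /eqP cr] /andP[/eqP sw wP].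
have uniq_s : uniq (map (matching_of (2 * n)) s).
  rewrite map_inj_in_uniq ?filter_uniq ?uniq_partner_lists // => w w'.
  by move=> /sP[sw wP _ _] /sP[sw' wP' _ _]; apply: matching_of_inj.
rewrite -(size_map (matching_of (2 * n))) -(card_uniqP uniq_s).
apply: eq_card => M; rewrite inE; apply/idP/mapP => [/and4P[Mm A1 A2 Mc]|[w ws ->]].
  have [w [sw wP ME]] := matching_of_surj Mm.
  exists w => //; rewrite mem_filter mem_partner_lists sw eqxx wP !andbT /avoider.
  by rewrite -(avoids12312 sw wP) -(avoids121323 sw wP) -(crossings_matching_of sw wP) -ME
             A1 A2.
have [sw wP /andP[A1 A2] cr] := sP w ws.
rewrite /is_matching matching_of_matching // avoids12312 // avoids121323 // A1 A2.
by rewrite crossings_matching_of // cr eqxx.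
Qed.

Import GRing.Theory Num.Theory.
Local Open Scope ring_scope.

Theorem theorem3 (n m : nat) (hn : (1 <= n)%N) :
  #|[set M : {set {set 'I_(2 * n)}} |
       [&& is_matching M,
           avoids M [:: 1; 2; 3; 1; 2]%N,
           avoids M [:: 1; 2; 1; 3; 2; 3]%N &
           crossings M == m]]|%:R
  = 1 / n%:R * ('C(n, m))%:R * ('C(2 * n - m, n + 1))%:R :> rat.
Proof.
rewrite card_matchings -mulrA -natrM addn1 -descendants1 // natrM div1r mulKf //.
by rewrite pnatr_eq0 -lt0n.
Qed.
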